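(* For $n\ge1$, the bicentral Eulerian numbers satisfy $$A(2n,n)\equiv\begin{cases}1\pmod 3&\text{if } n\in 3T(01)+1,\\ -1\pmod 3&\text{if } n\in 3T(01)\text{ or } n\in 3T(01)+2,\\ 0\pmod 3&\text{otherwise.}\end{cases}$$
   Context: The Eulerian number $A(n,k)$ is the number of permutations of $\{1,\ldots,n\}$ with exactly $k-1$ descents; equivalently $A(n,k)=\sum_{i=0}^{k}(-1)^i(k-i)^n\binom{n+1}{i}$. $T(01)$ denotes the set of $m\in\mathbb{N}$ whose base-$3$ expansion contains only digits $0$ and $1$; for integers $k,l$, $kT(01)+l=\{km+l : m\in T(01)\}$. *)

(* Defs.v *)
From mathcomp Require Import all_boot all_order all_algebra all_fingroup.

Set Implicit Arguments.
Unset Strict Implicit.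
Unset Printing Implicit Defensive.

Import GRing.Theory.

(* Permutations of {1, ..., n} are represented by 'S_n, acting on the
   order-isomorphic set {0, ..., n - 1}. *)
Definition descent_set (n : nat) (s : 'S_n) : {set 'I_n} :=
  [set i : 'I_n | [exists j : 'I_n, (val j == i.+1) && (s j < s i)]].

(* Having k - 1 descents is written without truncated subtraction, so that
   eulerian n 0 = 0. *)
Definition eulerian (n k : nat) : nat :=
  #|[set s : 'S_n | #|descent_set s|.+1 == k]|.

Definition digit (b m i : nat) : nat := (m %/ b ^ i) %% b.

(* The natural numbers include 0, which belongs to T(01): all of its digits
   are 0, as are the leading digits of any m beyond its expansion. *)
Definition T01 (m : nat) : Prop :=
  forall i : nat, digit 3 m i = 0 \/ digit 3 m i = 1.

(* The predicate of membership in k T(01) + l. *)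
Definition affT01 (k l z : int) : Prop :=
  exists2 m : nat, T01 m & z = (k * m%:Z + l)%R.

(* Main.v *)
(** Inserting a new maximum into a permutation of n letters either keeps the
    number of descents (at the end, or inside a descent) or raises it by one, so
    the Eulerian polynomials satisfy
    [E_(n+1) = X (1 - X) E_n' + (n + 1) X E_n].  Modulo 3 the solution is
    [E_(2m+1) = X (1 - X)^(2m)] and [E_(2m+2) = (X + X^2) (1 - X)^(2m)].
    With [t_m] the coefficient of [X^m] in [(1 - X)^(2m)], this gives
    [A(2n, n) = - (t_(n-1) + t_n)] modulo 3, and [(1 - X)^3 = 1 - X^3] yields
    [t_(3q) = t_(3q+1) = t_q] and [t_(3q+2) = 0], so that [t_m] is the
    indicator function of [T(01)]. *)
Require Import Defs.
From mathcomp Require Import all_boot all_order all_algebra all_fingroup.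
From mathcomp Require Import ring zify.

Set Implicit Arguments.
Unset Strict Implicit.
Unset Printing Implicit Defensive.

Import GRing.Theory.

(** * Descents after insertion of a new maximum *)

Lemma descent_lt n (s : 'S_n) (p : 'I_n) : p \in descent_set s -> p.+1 < n.
Proof. by rewrite inE => /existsP[j /andP[/eqP <- _]]; apply: ltn_ord. Qed.

Lemma lift_ord_max n (p : 'I_n) : lift ord_max p = p :> nat.
Proof. by rewrite /= /bump leqNgt ltn_ord. Qed.

Lemma descent_insert_max n (i : 'I_n.+1) (s : 'S_n) :
  (i \in descent_set (lift_perm i ord_max s)) = (i < n).
Proof.
rewrite inE lift_perm_id; apply/existsP/idP => [[j /andP[/eqP ji]]|lt_in].
  by move=> _; have := ltn_ord j; rewrite ji ltnS.
exists (lift i (Ordinal lt_in)); rewrite lift_perm_lift lift_ord_max ltn_ord.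
by rewrite andbT /= /bump leqnn.
Qed.

(** An old position keeps its right neighbour, up to a shift, unless the maximum lands just after
    it; it then becomes an ascent. *)
Lemma descent_insert_max_lift n (i : 'I_n.+1) (s : 'S_n) (p : 'I_n) :
  (lift i p \in descent_set (lift_perm i ord_max s)) =
    (p.+1 != i) && (p \in descent_set s).
Proof.
rewrite !inE lift_perm_lift lift_ord_max.
apply/existsP/andP => [[j]|[npi /existsP[q /andP[/eqP /= qp lt_s]]]].
  case: (unliftP i j) => [q|] ->; last first.
    by rewrite lift_perm_id [val ord_max]/= ltnNge ltnW ?andbF.
  rewrite lift_perm_lift lift_ord_max => /andP[/eqP /= qp lt_s].
  move: qp; rewrite /bump => qp; split; first by apply/eqP; lia.
  by apply/existsP; exists q; rewrite lt_s andbT; apply/eqP; lia.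
exists (lift i q); rewrite lift_perm_lift lift_ord_max lt_s andbT /= /bump.
by move/eqP: npi => npi; apply/eqP; lia.
Qed.

(* Inserting at [i = p + 1] splits the adjacent positions [p] and [p + 1]. *)
Definition precedes_descent n (s : 'S_n) (i : 'I_n.+1) : bool :=
  if unlift ord0 i is Some p then p \in descent_set s else false.

Lemma card_mem_sum (T : finType) (A : {set T}) : #|A| = \sum_x (x \in A).
Proof. by rewrite -sum1_card big_mkcond. Qed.

(** The maximum creates a descent at [i] unless it comes last, and destroys the descent that it
    splits, if any. The additive form avoids truncated subtraction. *)
Lemma card_descent_insert_max n (i : 'I_n.+1) (s : 'S_n) :
  #|descent_set (lift_perm i ord_max s)| + precedes_descent s i =
  #|descent_set s| + (i < n).
Proof.
rewrite card_mem_sum (bigD1_ord i) //= descent_insert_max.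
under eq_bigr do rewrite descent_insert_max_lift.
rewrite addnC addnCA addnC; congr (_ + _); rewrite /precedes_descent.
case: unliftP => [p|] -> /=.
  rewrite card_mem_sum (bigD1 p) //= [in RHS](bigD1 p) //= /bump leq0n add1n eqxx /=.
  rewrite add0n; congr (_ + _); apply: eq_bigr => q.
  by rewrite eqSS => /negbTE; rewrite -val_eqE /= => ->.
by rewrite add0n card_mem_sum; apply: eq_bigr.
Qed.

Lemma sum_precedes_descent n (s : 'S_n) :
  \sum_i precedes_descent s i = #|descent_set s|.
Proof.
rewrite big_ord_recl /precedes_descent unlift_none add0n card_mem_sum.
by apply: eq_bigr => p _; rewrite liftK.
Qed.

Local Open Scope ring_scope.

(** * Eulerian polynomials and their recurrence *)

Definition eulerian_poly (R : nzRingType) (n : nat) : {poly R} :=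
  \sum_(s : 'S_n) 'X^(#|descent_set s|.+1).

Lemma coef_eulerian_poly (R : nzRingType) n k :
  (eulerian_poly R n)`_k = (eulerian n k)%:R.
Proof.
rewrite coef_sum /eulerian -sum1_card natr_sum [RHS]big_mkcond /=.
by apply: eq_bigr => s _; rewrite coefXn inE eq_sym; case: eqP.
Qed.

(** Insertion is injective, since [i] is recovered as the preimage of the maximum, and
    [n! (n + 1) = (n + 1)!] makes it bijective. *)
Lemma big_lift_perm_max (V : nmodType) n (F : 'S_n.+1 -> V) :
  \sum_s F s = \sum_(s : 'S_n) \sum_(i < n.+1) F (lift_perm i ord_max s).
Proof.
pose ins (x : 'S_n * 'I_n.+1) := lift_perm x.2 ord_max x.1.
have ins_inj : injective ins.
  move=> [s i] [s' i'] /= eq_ins.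
  have eq_i : i = i'.
    apply: (@perm_inj _ (ins (s, i))); rewrite [in RHS]eq_ins.
    by rewrite /ins !lift_perm_id.
  rewrite -eq_i in eq_ins *; congr pair; apply/permP => p.
  by apply: (@lift_inj _ ord_max); rewrite -!(lift_perm_lift i) [lift_perm _ _ _]eq_ins.
rewrite pair_big (reindex ins) //; apply/onW_bij/(inj_card_bij ins_inj).
by rewrite card_prod card_ord !card_Sn factS mulnC.
Qed.

Lemma eulerian_polyS (R : comNzRingType) n :
  eulerian_poly R n.+1 =
    'X * (1 - 'X) * (eulerian_poly R n)^`() + n.+1%:R * 'X * eulerian_poly R n.
Proof.
rewrite /eulerian_poly big_lift_perm_max raddf_sum !mulr_sumr -big_split /=.
apply: eq_bigr => s _; set d := #|descent_set s|.
(* The two indicators mark the [d + 1] positions that create no descent; they never hold together,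
   as no descent sits at the last letter. *)
have eq_term (i : 'I_n.+1) :
    'X^(#|descent_set (lift_perm i ord_max s)|.+1) =
    'X^(d.+2) + ((i == ord_max) + precedes_descent s i)%:R * ('X^(d.+1) - 'X^(d.+2))
      :> {poly R}.
  have := card_descent_insert_max i s; rewrite -/d.
  have [->|ni] := eqVneq i ord_max.
    rewrite ltnn addn0 /precedes_descent; case: unliftP => [p|] /= eq_p.
      case: (boolP (p \in _)) => [/descent_lt | _].
        by move/(congr1 val): eq_p => /=; rewrite /bump; lia.
      by rewrite addn0 => -> /=; ring.
    by rewrite addn0 => -> /=; ring.
  have -> : (i < n)%N by move: ni (ltn_ord i); rewrite -val_eqE /=; lia.
  case: precedes_descent => /= [/addIn ->|]; first ring.
  by rewrite addn0 addn1 => ->; ring.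
rewrite (eq_bigr _ (fun i _ => eq_term i)) big_split /= sumr_const card_ord.
rewrite -mulr_suml -natr_sum big_split /= sum_precedes_descent -/d.
rewrite (bigD1 ord_max) //= eqxx big1 => [|i /negbTE -> //].
rewrite derivXn /= -['X^_ *+ n.+1]mulr_natl -['X^_ *+ d.+1]mulr_natl !exprS.
by rewrite addn0 add1n; ring.
Qed.

Lemma eulerian_poly1 (R : comNzRingType) : eulerian_poly R 1 = 'X.
Proof.
rewrite eulerian_polyS.
have -> : eulerian_poly R 0 = 'X.
  rewrite /eulerian_poly (eq_bigr (fun=> 'X)) => [|s _].
    by rewrite sumr_const card_Sn.
  by rewrite (_ : #|_| = 0%N) //; apply: eq_card0 => -[].
rewrite derivX; ring.
Qed.

(** * Closed forms modulo 3 *)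

Lemma natr3_polyF3 : 3%:R = 0 :> {poly 'F_3}.
Proof. by rewrite -polyC_natr pchar_Fp_0. Qed.

Lemma deriv_sub1X_exp (R : comNzRingType) n :
  (1 - 'X) * ((1 - 'X) ^+ n)^`() = - n%:R * (1 - 'X) ^+ n :> {poly R}.
Proof.
rewrite deriv_exp derivB derivX -polyC1 derivC polyC1.
case: n => [|n]; first by rewrite mulr0n; ring.
by rewrite /= -[_ *+ n.+1]mulr_natl exprS; ring.
Qed.

Lemma eulerian_poly_F3 n :
  eulerian_poly 'F_3 n.*2.+1 = 'X * (1 - 'X) ^+ n.*2 /\
  eulerian_poly 'F_3 n.*2.+2 = ('X + 'X^2) * (1 - 'X) ^+ n.*2.
Proof.
have even_step m : eulerian_poly 'F_3 m.*2.+1 = 'X * (1 - 'X) ^+ m.*2 ->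
    eulerian_poly 'F_3 m.*2.+2 = ('X + 'X^2) * (1 - 'X) ^+ m.*2.
  move=> odd_m; rewrite eulerian_polyS odd_m derivM derivX mul1r mulrDr.
  set D := ((1 - 'X) ^+ m.*2)^`(); set Q := (1 - 'X) ^+ m.*2.
  have -> : 'X * (1 - 'X) * ('X * D) = 'X ^+ 2 * ((1 - 'X) * D) by ring.
  by rewrite deriv_sub1X_exp -/Q -[m.*2.+2]addn2 natrD; ring.
elim: n => [|n [_ even_n]].
  have odd0 : eulerian_poly 'F_3 1 = 'X * (1 - 'X) ^+ 0.
    by rewrite eulerian_poly1 expr0 mulr1.
  by split=> //; apply: even_step 0%N odd0.
have odd_n : eulerian_poly 'F_3 n.+1.*2.+1 = 'X * (1 - 'X) ^+ n.+1.*2.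
  rewrite doubleS eulerian_polyS even_n derivM derivD derivX derivXn mulrDr.
  rewrite (exprD _ 2 n.*2) -[_.*2.+3]addn3.
  set D := ((1 - 'X) ^+ n.*2)^`(); set Q := (1 - 'X) ^+ n.*2.
  have -> : 'X * (1 - 'X) * (('X + 'X^2) * D) = 'X * ('X + 'X^2) * ((1 - 'X) * D).
    by ring.
  rewrite deriv_sub1X_exp -/Q natrD natr3_polyF3 expr1 -mulr_natl.
  (* Modulo 3 the derivative [1 + 2X] of [X + X^2] equals [1 - X], which supplies the second new
     factor. *)
  transitivity ('X * ((1 - 'X) ^+ 2 * Q) + 3%:R * (('X - 'X^2) * 'X * Q)); first by ring.
  by rewrite natr3_polyF3; ring.
by split=> //; apply: even_step.
Qed.

(** * Coefficients of powers of [1 - X] *)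

Lemma coef_sub1X_exp (R : comNzRingType) n k :
  ((1 - 'X) ^+ n : {poly R})`_k = (-1) ^+ k * 'C(n, k)%:R.
Proof.
rewrite exprBn coef_sum.
under eq_bigr => i _.
  rewrite expr1n mulr1 coefMn -(rmorph_sign (@polyC R)) coefCM coefXn.
  over.
have [lt_kn|lt_nk] := ltnP k n.+1; last first.
  rewrite bin_small // mulr0 big1 // => i _.
  by rewrite gtn_eqF ?mulr0 ?mul0rn // (leq_trans (ltn_ord i)).
rewrite (bigD1 (Ordinal lt_kn)) //= eqxx mulr1 mulr_natr big1 ?addr0 // => i.
by rewrite -val_eqE /= eq_sym => /negbTE ->; rewrite mulr0 mul0rn.
Qed.

(** The indices are symmetric about the middle [m + 1], and they have the same parity, hence the
    same sign. *)
Lemma coef_sub1X_exp_sym (R : comNzRingType) m :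
  ((1 - 'X) ^+ m.+1.*2 : {poly R})`_m.+2 = ((1 - 'X) ^+ m.+1.*2)`_m.
Proof.
rewrite !coef_sub1X_exp !exprS !mulN1r opprK -[in RHS]bin_sub; last by lia.
by congr (_ * 'C(_, _)%:R); lia.
Qed.

Lemma sub1X_exp_F3 m r :
  (1 - 'X) ^+ (3 * m + r).*2 =
    ((1 - 'X) ^+ m.*2 \Po 'X^3) * (1 - 'X) ^+ r.*2 :> {poly 'F_3}.
Proof.
rewrite rmorphXn /= rmorphB /= comp_polyX -polyC1 comp_polyC polyC1.
rewrite doubleD exprD -muln2 -mulnA muln2 exprM; congr (_ ^+ _ * _).
transitivity (1 - 'X^3 + 3%:R * ('X^2 - 'X) : {poly 'F_3}); first by ring.
by rewrite natr3_polyF3; ring.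
Qed.

Lemma coef_comp_Xn_residue (R : nzSemiRingType) (p : {poly R}) d k r i :
  (r < d)%N -> i = (d * k + r)%N -> (p \Po 'X^d)`_i = p`_k *+ (r == 0%N).
Proof.
move=> lt_rd ->; rewrite coef_comp_poly_Xn ?(leq_ltn_trans _ lt_rd) //.
rewrite dvdn_addr ?dvdn_mulr // /dvdn modn_small //.
case: eqP => [->|]; last by rewrite mulr0n.
by rewrite addn0 mulKn // (leq_ltn_trans _ lt_rd).
Qed.

(* [central m] is the class of [(-1)^m * binomial (2m) m]; the sign makes it the
   indicator function of [T(01)]. *)
Definition central (m : nat) : 'F_3 := ((1 - 'X) ^+ m.*2)`_m.

Lemma central_residue q r :
  (r < 3)%N -> central (3 * q + r)%N = if (r < 2)%N then central q else 0.
Proof.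
move=> lt_r3; rewrite /central sub1X_exp_F3; set P := _ \Po _.
case: r lt_r3 => [|[|[|//]]] _ /=.
- by rewrite expr0 mulr1 (@coef_comp_Xn_residue _ _ 3 q 0).
(* Of the indices [3q + 1], [3q], [3q - 1] picked out by this factor, only [3q] meets the support of
   [P]. *)
- have -> : (1 - 'X) ^+ 2 = 1 + 'X + 'X^2 :> {poly 'F_3}.
    transitivity (1 + 'X + 'X^2 - 3%:R * 'X : {poly 'F_3}); first by ring.
    by rewrite natr3_polyF3; ring.
  rewrite !mulrDr mulr1 !coefD coefMX coefMXn addn1 /=.
  rewrite [P`_ _.+1](@coef_comp_Xn_residue _ _ 3 q 1) ?addn1 // mulr0n add0r.
  rewrite [P`_(3 * q)](@coef_comp_Xn_residue _ _ 3 q 0) ?addn0 // mulr1n.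
  case: ltnP => [|le_2]; rewrite ?addr0 //.
  by rewrite [P`_ _](@coef_comp_Xn_residue _ _ 3 q.-1 2) ?mulr0n ?addr0 //; lia.
(* Absorbing a further cube leaves only the indices [3q + 2] and [3q + 1], neither a multiple of
   3. *)
- have -> : P * (1 - 'X) ^+ 4 = ((1 - 'X) ^+ q.*2.+1 \Po 'X^3) * (1 - 'X).
    rewrite (exprSr _ q.*2) comp_polyM -/P rmorphB /= comp_polyX -polyC1 comp_polyC polyC1.
    transitivity (P * (1 - 'X^3) * (1 - 'X) + 3%:R * P * (- 'X + 2%:R * 'X^2 - 'X^3)).
      by ring.
    by rewrite natr3_polyF3; ring.
  rewrite mulrBr mulr1 coefB coefMX addn2 /=.
  rewrite (@coef_comp_Xn_residue _ _ 3 q 2) ?addn2 //.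
  by rewrite (@coef_comp_Xn_residue _ _ 3 q 1) ?addn1 // !mulr0n subr0.
Qed.

(** * Ternary digits and the indicator of [T01] *)

Lemma digit3S m i : digit 3 m i.+1 = digit 3 (m %/ 3)%N i.
Proof. by rewrite /digit expnS divnMA. Qed.

Lemma T01_residue m : T01 m <-> (m %% 3 < 2)%N /\ T01 (m %/ 3)%N.
Proof.
split=> [m01|[lt_r2 q01] [|i]]; last by rewrite digit3S.
  split=> [|i]; last by rewrite -digit3S.
  by case: (m01 0%N); rewrite /digit divn1 => ->.
by rewrite /digit divn1; case: (m %% 3)%N lt_r2 => [|[|]]; auto.
Qed.

(** Strong induction strips the last ternary digit. Two implications are stated because [T01] is a
    proposition, not a boolean. *)
Lemma central_T01 m : (T01 m -> central m = 1) /\ (~ T01 m -> central m = 0).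
Proof.
elim/ltn_ind: m => m IHm.
have [->|m_gt0] := posnP m.
  rewrite /central double0 expr0 coef1; split=> // -[].
  by move=> i; rewrite /digit div0n; left.
have [q01 qN01] := IHm _ (ltn_Pdiv (isT : 1 < 3)%N m_gt0).
have := central_residue (m %/ 3)%N (ltn_pmod m (isT : 0 < 3)%N).
rewrite mulnC -divn_eq T01_residue => ->.
case: ltnP => _; split=> //; [by case | | by case].
by move=> m01; apply: qN01 => q; apply: m01.
Qed.

(** * Bicentral Eulerian numbers modulo 3 *)

Lemma eulerian_central_F3 n : (0 < n)%N ->
  (eulerian (2 * n) n)%:R = - (central n.-1 + central n) :> 'F_3.
Proof.
case: n => // m _; rewrite -coef_eulerian_poly mul2n doubleS.
rewrite (eulerian_poly_F3 m).2 /= /central.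
have -> : (1 - 'X) ^+ m.+1.*2 = (1 + 'X + 'X^2) * (1 - 'X) ^+ m.*2 :> {poly 'F_3}.
  rewrite doubleS (exprD _ 2 m.*2).
  transitivity ((1 + 'X + 'X^2 - 3%:R * 'X) * (1 - 'X) ^+ m.*2 : {poly 'F_3}).
    by ring.
  by rewrite natr3_polyF3; ring.
rewrite !mulrDl mul1r !coefD !coefXM !coefXnM /=.
set Q := (1 - 'X) ^+ m.*2.
(* For [m = 0] both sides vanish; otherwise this is the symmetry of binomials. *)
have sym : Q`_m.+1 = (if (m.+1 < 2)%N then 0 else Q`_(m.+1 - 2)).
  rewrite /Q; case: m @Q => [|m] Q; first by rewrite /Q expr0 coef1.
  by rewrite ltnS /= subSS subn1 coef_sub1X_exp_sym.
rewrite -sym.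
(* By symmetry the right side is [-2] times the left, and [-2 = 1] modulo 3. *)
transitivity (Q`_m + Q`_m.+1 - 3%:R * (Q`_m + Q`_m.+1)); last by ring.
by rewrite pchar_Fp_0 // mul0r subr0.
Qed.

Lemma eulerian_residue_F3 n : (0 < n)%N ->
  (eulerian (2 * n) n)%:R =
    (if (n %% 3 == 1)%N then 1 else -1) * central (n %/ 3)%N :> 'F_3.
Proof.
move=> n_gt0; rewrite eulerian_central_F3 //.
have three0 := pchar_Fp_0 (isT : prime 3).
have := divn_eq n 3; have := ltn_pmod n (isT : 0 < 3)%N.
set q := (n %/ 3)%N.
have cq r := @central_residue q r.
have c0 := cq 0%N isT; rewrite addn0 in c0.
have c1 := cq 1%N isT; rewrite addn1 in c1.
have c2 := cq 2%N isT; rewrite addn2 in c2.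
case: (n %% 3)%N => [|[|[|//]]] _ def_n; rewrite def_n mulnC.
(* Here [n > 0] forces [q > 0], so the predecessor has residue 2, where [central] vanishes. *)
- have -> : (3 * q + 0).-1 = (3 * q.-1 + 2)%N by lia.
  by rewrite addn0 c0 central_residue //= add0r mulN1r.
- rewrite addn1 /= c0 c1 /= mul1r.
  transitivity (central q - 3%:R * central q); first by ring.
  by rewrite three0 mul0r subr0.
- by rewrite addn2 /= c1 c2 addr0 mulN1r.
Qed.

Lemma affT01_residue (r n : nat) : (r < 3)%N ->
  affT01 3 r n <-> (n %% 3)%N = r /\ T01 (n %/ 3)%N.
Proof.
move=> lt_r3; split=> [[q q01 def_n]|[def_r q01]].
  have -> : n = (q * 3 + r)%N by lia.
  by rewrite modnMDl divnMDl // modn_small // divn_small // addn0.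
exists (n %/ 3)%N => //; lia.
Qed.

Lemma F3_modz (m r : nat) : m%:R = r%:R :> 'F_3 -> (m%:Z = r%:Z %[mod 3])%Z.
Proof.
move=> eq_mr; have := val_Fp_nat (isT : prime 3) m.
by rewrite eq_mr val_Fp_nat // !modz_nat => ->.
Qed.

Local Close Scope ring_scope.

Theorem theorem5p10 (n : nat) (hn : 1 <= n) :
  [/\ affT01 3 1 n%:Z -> ((eulerian (2 * n) n)%:Z = 1 %[mod 3])%Z,
      affT01 3 0 n%:Z \/ affT01 3 2 n%:Z ->
        ((eulerian (2 * n) n)%:Z = -1 %[mod 3])%Z
    & ~ affT01 3 1 n%:Z -> ~ affT01 3 0 n%:Z -> ~ affT01 3 2 n%:Z ->
        ((eulerian (2 * n) n)%:Z = 0 %[mod 3])%Z].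
Proof.
have [q01 qN01] := central_T01 (n %/ 3)%N.
have eul := eulerian_residue_F3 hn.
have aff0 := @affT01_residue 0 n isT; have aff1 := @affT01_residue 1 n isT.
have aff2 := @affT01_residue 2 n isT.
split.
- move=> /aff1[r1 /q01 q1]; apply: (@F3_modz _ 1).
  by rewrite eul r1 q1 mulr1.
- move=> r02; rewrite (_ : (-1 %% 3)%Z = (2%N %% 3)%Z) //; apply: F3_modz.
  by rewrite eul; case: r02 => [/aff0|/aff2] -[-> /q01 ->]; apply/eqP.
- move=> n1 n0 n2; apply: (@F3_modz _ 0).
  (* If [n %/ 3] were in [T01], the residue of [n] would put it in one of the three excluded
     classes. *)
  rewrite eul qN01 ?mulr0 // => q3; have := ltn_pmod n (isT : 0 < 3).
  by case def_r: (n %% 3) => [|[|[|//]]] _; [apply/n0/aff0|apply/n1/aff1|apply/n2/aff2].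
Qed.
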